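(* For all $\lambda,\mu\in P_+$ and all $n\in\frac1N\mathbb Z$ one has \[(F_\lambda^\dagger)_{(n)}F_\mu^\dagger\subset F_{\lambda+\mu}^\dagger,\] that is, $A_{(n)}B\in F^\dagger_{\lambda+\mu}$ for all $A\in F^\dagger_\lambda$, $B\in F^\dagger_\mu$.
   Context: Let $\mathfrak g$ be a simple complex Lie algebra of type $ADE$ and rank $r$, with Cartan subalgebra $\mathfrak h$, simple roots $\alpha_i$, fundamental weights $\omega_i$, weight lattice $P$, root lattice $Q$, dominant cone $P_+=\bigoplus_{i}\mathbb Z_{\ge0}\omega_i$, and invariant form $(\cdot,\cdot)$ normalized by $(\alpha,\alpha)=2$ for roots (used to identify $\mathfrak h\simeq\mathfrak h^*$). Order on $P$: $\mu\le\lambda$ iff $\lambda-\mu=\sum a_i\alpha_i$ with $a_i\in\mathbb Z_{\ge0}$. Put $\mathfrak g[t]=\mathfrak g\otimes\mathbb C[t]$, $xt^k=x\otimes t^k$; $\widehat{\mathfrak g}$ is the untwisted affine Kac–Moody algebra of $\mathfrak g$; $N$ is the exponent of the finite group $P/Q$. Level one vertex operators. $\mathbb L=\bigoplus_{i=0}^d L(\Lambda_i)$ is the direct sum of all irreducible integrable level one $\widehat{\mathfrak g}$-modules; it is graded by $P/Q$, with components $\mathbb L_g$ equal to the $L(\Lambda_i)$, and $\mathbb L_0=L(\Lambda_0)$. As a vector space $\mathbb L=S(t^{-1}\mathfrak h[t^{-1}])\otimes\mathbb C[P]$, $e^\lambda:=1\otimes e^\lambda$, $|0\rangle=e^0$,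 where $\mathbb L_g$ involves the $e^\lambda$ with $\lambda$ in the coset $g$; $ht^k$ ($k\ne0$) act by the Fock representation of the Heisenberg algebra $[h_1t^k,h_2t^l]=k\delta_{k+l,0}(h_1,h_2)$, and $ht^0$ acts on the $e^\lambda$ part by $(h,\lambda)$. To each $A\in\mathbb L$ is attached, linearly, a field $Y(A,z)=\sum_{n\in\frac1N\mathbb Z}A_{(n)}z^{-n-1}$: $Y(ht^{-1},z)=\sum_k ht^kz^{-k-1}$, $Y(ht^{-1-n},z)=\frac1{n!}\partial_z^nY(ht^{-1},z)$, $Y(e^\lambda,z)=\exp(\sum_{n>0}\frac{\lambda t^{-n}}nz^n)\exp(\sum_{n<0}\frac{\lambda t^{-n}}nz^n)e^\lambda z^\lambda$ with $z^\lambda e^\mu=z^{(\lambda,\mu)}e^\mu$, $e^\lambda e^\mu=\epsilon(\lambda,\mu)e^{\lambda+\mu}$, and $Y(ab,z)={:}Y(a,z)Y(b,z){:}$ (normally ordered product) for $a\in t^{-1}\mathfrak h[t^{-1}]$, $b\in\mathbb L$. Here $\epsilon:P\times P\to\{\pm1\}$, $\epsilon(0,\mu)=\epsilon(\mu,0)=1$, is a fixed choice of signs such that $\mathbb L_0$ is the lattice vertex algebra of $Q$, its modes $e_\alpha t^n=(e^\alpha)_{(n)}$, $ht^n=(ht^{-1})_{(n)}$ give the action of $\widehat{\mathfrak g}$ on $\mathbb L$, and each restriction $\mathbb L_g\otimes\mathbb L_h\to\mathbb L_{g+h}$ of $Y$ is an intertwining operator for $\mathbb L_0$; in particular $[xt^m,b_{(k)}]=\sum_{j\ge0}\binom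 mj(xt^jb)_{(m+k-j)}$ for $x\in\mathfrak g$, $m\in\mathbb Z$, $b\in\mathbb L$. Filtration. For $\lambda\in P_+$ let $L(\Lambda_i)$ be the summand of $\mathbb L$ containing $e^\lambda$. Then $F^\dagger_\lambda\subset L(\Lambda_i)$ is the subspace of all $v\in L(\Lambda_i)$ such that all $\mathfrak h$-weights of $U(\mathfrak g[t])v$ are $\le\lambda$. For subspaces, $U_{(n)}U'$ denotes the span of the $u_{(n)}u'$. *)

(* Defs.v *)
From HB Require Import structures.
From mathcomp Require Import all_boot all_order all_algebra.
From mathcomp Require Import finmap multiset.
From mathcomp.multinomials Require Export monalg.
From mathcomp Require Import boolp classical_sets fsbigop reals complex.
Set Implicit Arguments.
Unset Strict Implicit.
Unset Printing Implicit Defensive.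
Import Order.TTheory GRing.Theory Num.Theory.

Local Open Scope classical_set_scope.
Local Open Scope ring_scope.

Inductive ade_type := TypeA of nat | TypeD of nat | TypeE6 | TypeE7 | TypeE8.

(* TypeA n is A_(n+1) and TypeD n is D_(n+4). *)
Definition rank (X : ade_type) : nat :=
  match X with
  | TypeA n => n.+1 | TypeD n => n.+4
  | TypeE6 => 6 | TypeE7 => 7 | TypeE8 => 8
  end.

(* Edges i -- j with i < j of the Dynkin diagram, in Bourbaki's labelling
   shifted to start at 0. *)
Definition dynkin_edge (X : ade_type) (i j : nat) : bool :=
  match X with
  | TypeA _ => j == i.+1
  | TypeD n => ((j == i.+1) && (j < n.+3)%N) || ((i == n.+1) && (j == n.+3))
  | _ => [|| (i == 0%N) && (j == 2%N), (i == 1%N) && (j == 3%N)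
           | (1 < i)%N && (j == i.+1)]
  end.

Definition cartan (X : ade_type) : 'M[int]_(rank X) :=
  \matrix_(i, j) (if i == j then 2
                  else if dynkin_edge X i j || dynkin_edge X j i then -1 else 0).

(* An element of P is the row of its coordinates in the basis of fundamental
   weights; equivalently, its i-th entry is its pairing with alpha_i. *)
Notation weight X := 'rV[int]_(rank X).

Section WeightLattice.
Context (X : ade_type).
Implicit Types (lam mu : weight X).

Definition simple_root (i : 'I_(rank X)) : weight X := row i (cartan X).

(* (omega_i, omega_j) is the (i, j) entry of the inverse Cartan matrix. *)
Definition wform lam mu : rat :=
  (map_mx intr lam *m invmx (map_mx intr (cartan X)) *m (map_mx intr mu)^T) 0 0.

Definition root_lattice : set (weight X) :=
  [set lam | exists c : 'I_(rank X) -> int, lam = \sum_i simple_root i *~ c i].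

Definition is_root : set (weight X) :=
  [set a | root_lattice a /\ wform a a = 2].

Definition dominant : set (weight X) := [set lam | forall i, 0 <= lam 0 i].

Definition wle mu lam : Prop :=
  exists a : 'I_(rank X) -> nat, lam - mu = \sum_i simple_root i *+ a i.

(* N is the exponent of P/Q. *)
Definition is_PQ_exponent (N : nat) : Prop :=
  (0 < N)%N /\
  forall k : nat, (forall lam, root_lattice (lam *+ k)) <-> (N %| k)%N.

End WeightLattice.

(* The free module on the monomials of S(t^-1 h[t^-1]) (x) C[P]: the variable
   (i, p) is alpha_i t^-(p+1), and (s, lam) is the product of the variables
   in s tensored with e^lam. *)
Notation fock_basis X := (multiset ('I_(rank X) * nat) * weight X)%type.
Notation fock C X := {malg C[fock_basis X]}.

Definition lspan (C : fieldType) (V : lmodType C) (S : set V) : set V :=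
  [set v | exists s : seq (C * V),
     (forall p, p \in s -> S p.2) /\ v = \sum_(p <- s) p.1 *: p.2].

Section VertexOperators.
Context (C : fieldType) (X : ade_type).
Local Notation r := (rank X).
Local Notation P := (weight X).
Local Notation L := (fock C X).
Implicit Types (lam mu : P) (n : rat) (v : L) (b : fock_basis X).

Definition lin_ext (f : fock_basis X -> L) (v : L) : L :=
  \sum_(b <- msupp v) v@_b *: f b.

Definition e_ (lam : P) : L := << (mset0, lam) >>.
Definition vac : L := e_ 0.
Definition ht1 (i : 'I_r) : L := << ([mset (i, 0%N)]%mset, 0) >>.

(* The component L_g of the grading by P/Q, for g the class of lam. *)
Definition sector (lam : P) : set L :=
  [set v | forall b, b \in msupp v -> root_lattice (b.2 - lam)].

(* The operator h t^k, for h with coordinates h 0 i in the basis alpha_i. *)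
Definition heis (h : 'rV[C]_r) (k : int) : L -> L :=
  lin_ext (fun b =>
    match k with
    | Negz p => \sum_i h 0 i *: << (((i, p) +` b.1)%mset, b.2) >>
    | Posz 0 => (\sum_i h 0 i * (b.2 0 i)%:~R) *: << b >>
    | Posz q.+1 =>
        (* k * (h, alpha_j) times the derivative with respect to alpha_j t^-k *)
        \sum_j (q.+1%:R * (\sum_i h 0 i * (cartan X i j)%:~R)
                * (b.1 (j, q))%:R) *: << ((b.1 `\ (j, q))%mset, b.2) >>
    end).

Definition alpha (i : 'I_r) : 'rV[C]_r := delta_mx 0 i.

(* lam in the basis alpha_i *)
Definition to_h (lam : P) : 'rV[C]_r :=
  map_mx intr lam *m invmx (map_mx intr (cartan X)).

(* Coefficients of z^p in (\sum_(k >= 1) A k z^k)^m and in its exponential. *)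
Fixpoint pow_coef (A : nat -> L -> L) (m p : nat) (v : L) : L :=
  match m with
  | 0 => if p == 0%N then v else 0
  | m'.+1 => \sum_(k < p) A k.+1 (pow_coef A m' (p - k.+1) v)
  end.
Definition exp_coef (A : nat -> L -> L) (p : nat) (v : L) : L :=
  \sum_(m < p.+1) (m`!%:R)^-1 *: pow_coef A m p v.

Definition exp_minus (lam : P) : nat -> L -> L :=
  exp_coef (fun k v => k%:R^-1 *: heis (to_h lam) (- k%:Z) v).
(* coefficient of z^-q *)
Definition exp_plus (lam : P) : nat -> L -> L :=
  exp_coef (fun k v => - k%:R^-1 *: heis (to_h lam) k%:Z v).

Definition zbinom (x : int) (p : nat) : C :=
  (\prod_(i < p) (x - i%:Z)%:~R) / p`!%:R.

(* (alpha_i t^(-1-p))_(j): the coefficient of z^(-j-1) in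
   (1/p!) (d/dz)^p \sum_k alpha_i t^k z^(-k-1). *)
Definition heis_mode (ip : 'I_r * nat) (j : int) (v : L) : L :=
  zbinom (ip.2%:Z - j - 1) ip.2 *: heis (alpha ip.1) (j - ip.2%:Z) v.

Context (eps : P -> P -> int).

(* (e^lam)_(n) *)
Definition exp_mode (lam : P) (n : rat) : L -> L :=
  lin_ext (fun b =>
    \sum_(pq \in [set pq : nat * nat |
                   pq.1%:R - pq.2%:R + wform lam b.2 = - n - 1])
      exp_minus lam pq.1 (exp_plus lam pq.2
        ((eps lam b.2)%:~R *: << (b.1, lam + b.2) >>))).

(* The n-th mode of the iterated normally ordered product. All the sums
   \sum_(_ \in _) in this file have finitely many nonzero terms. *)
Fixpoint monomial_mode (s : seq ('I_r * nat)) (lam : P) (n : rat) (v : L) : L :=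
  match s with
  | [::] => exp_mode lam n v
  | ip :: s' =>
      \sum_(j \in [set j : int | j < 0])
        heis_mode ip j (monomial_mode s' lam (n - j%:~R - 1) v)
      + \sum_(j \in [set j : int | 0 <= j])
          monomial_mode s' lam (n - j%:~R - 1) (heis_mode ip j v)
  end.

(* A_(n) B; the order in which enum_mset lists a monomial is immaterial. *)
Definition vmode (A : L) (n : rat) (B : L) : L :=
  \sum_(a <- msupp A) \sum_(b <- msupp B)
     (A@_a * B@_b) *: monomial_mode (enum_mset a.1) a.2 n << b >>.

Definition mode_span (n : rat) (U U' : set L) : set L :=
  lspan [set v | exists A B, [/\ U A, U' B & v = vmode A n B]].

Definition borcherds (a b c : L) : Prop :=
  forall (m n : int) (k : rat),
    \sum_(j \in [set: nat])
      zbinom m j *: vmode (vmode a (n + j%:Z)%:~R b) (m%:~R + k - j%:R) c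
  = \sum_(j \in [set: nat])
      ((-1) ^+ j * zbinom n j) *:
        (vmode a (m + n - j%:Z)%:~R (vmode b (k + j%:R) c)
         - (-1) ^ n *: vmode b (n%:~R + k - j%:R) (vmode a (m + j%:Z)%:~R c)).

(* L_(-1) = omega_(0), with omega the conformal vector
   1/2 \sum_(i, j) (omega_i, omega_j) alpha_i t^-1 alpha_j t^-1. *)
Definition conformal : L :=
  \sum_i \sum_j (2^-1 * invmx (map_mx intr (cartan X)) i j) *:
     << ([mset (i, 0%N); (j, 0%N)]%mset, 0) >>.
Definition Lm1 (v : L) : L := vmode conformal 0 v.

(* Y is an intertwining operator L_g (x) L_h -> L_(g+h) for L_0, where g, h are
   the classes of lam, mu. *)
Definition intertwining (lam mu : P) : Prop :=
  forall b c : L, sector lam b -> sector mu c ->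
    [/\ forall k, sector (lam + mu) (vmode b k c),
        exists K : rat, forall k, K <= k -> vmode b k c = 0,
        forall k, vmode (Lm1 b) k c = - ratr k *: vmode b (k - 1) c
      & forall a, sector 0 a -> borcherds a b c].

(* Vertex algebra axioms for (L_0, Y, |0>, L_(-1)); locality is part of the
   Borcherds identity. *)
Definition L0_vertex_algebra : Prop :=
  [/\ forall a, sector 0 a ->
        vmode a (-1) vac = a /\ forall k : nat, vmode a k%:R vac = 0,
      forall (n : int) a, sector 0 a ->
        vmode vac n%:~R a = if n == -1 then a else 0
    & intertwining 0 0].

End VertexOperators.

Record lie_algebra (C : fieldType) := LieAlgebra {
  lie_space :> vectType C;
  bracket : lie_space -> lie_space -> lie_space;
  bracketPl : forall a x y z,
    bracket (a *: x + y) z = a *: bracket x z + bracket y z;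
  bracketPr : forall a x y z,
    bracket z (a *: x + y) = a *: bracket z x + bracket z y;
  bracketxx : forall x, bracket x x = 0;
  bracket_jacobi : forall x y z,
    bracket x (bracket y z) + bracket y (bracket z x)
      + bracket z (bracket x y) = 0 }.

Definition simple_lie (C : fieldType) (g : lie_algebra C) : Prop :=
  (exists x y : g, bracket x y <> 0) /\
  forall I : {vspace g}, (forall x y, y \in I -> bracket x y \in I) ->
    I = 0%VS \/ I = fullv.

Section AffineAction.
Context (C : fieldType) (X : ade_type) (g : lie_algebra C).
Local Notation r := (rank X).
Local Notation P := (weight X).
Local Notation L := (fock C X).
Context (h : 'I_r -> g) (e : P -> g).

(* The h i form a basis of a Cartan subalgebra of g whose root system is of
   type X, with h i corresponding to the simple root alpha_i under the
   normalized form; e a is a root vector for each root a (and is irrelevant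
   when a is not a root). *)
Record root_decomposition : Prop := RootDecomposition {
  cartan_free : free [seq h i | i <- enum 'I_r];
  cartan_abelian : forall i j, bracket (h i) (h j) = 0;
  root_vector_neq0 : forall a, is_root a -> e a != 0;
  root_vector_weight : forall a i, is_root a ->
    bracket (h i) (e a) = (a 0 i)%:~R *: e a;
  root_span : forall U : {vspace g}, (forall i, h i \in U) ->
    (forall a, is_root a -> e a \in U) -> U = fullv }.

Record normalized_form (kappa : g -> g -> C) : Prop := NormalizedForm {
  kappa_linear : forall a x y z,
    kappa (a *: x + y) z = a * kappa x z + kappa y z;
  kappa_sym : forall x y, kappa x y = kappa y x;
  kappa_inv : forall x y z, kappa (bracket x y) z = kappa x (bracket y z);
  kappa_cartan : forall i j, kappa (h i) (h j) = (cartan X i j)%:~R }.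

(* A level one action of the affine algebra on L, rho x m being the action of
   x t^m: the central element K, with
   [x t^m, y t^n] = [x, y] t^(m+n) + m delta_(m+n,0) (x, y) K, acts by 1. *)
Record level_one_action (kappa : g -> g -> C) (rho : g -> int -> L -> L) : Prop
    := LevelOneAction {
  rho_linear_l : forall a x y m v,
    rho (a *: x + y) m v = a *: rho x m v + rho y m v;
  rho_linear_r : forall x m a u v,
    rho x m (a *: u + v) = a *: rho x m u + rho x m v;
  rho_bracket : forall x y m n v,
    rho x m (rho y n v) - rho y n (rho x m v)
    = rho (bracket x y) (m + n) v
      + (if m + n == 0 then m%:~R * kappa x y else 0) *: v }.

(* The choice of signs is such that L_0 is a vertex algebra, that the modes of
   the h t^-1 and of the e^a give the action rho, and that Y restricts to
   intertwining operators. *)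
Record admissible_signs (rho : g -> int -> L -> L) (eps : P -> P -> int) : Prop
    := AdmissibleSigns {
  eps_sign : forall lam mu, eps lam mu = 1 \/ eps lam mu = -1;
  eps0l : forall mu, eps 0 mu = 1;
  eps0r : forall mu, eps mu 0 = 1;
  eps_vertex_algebra : L0_vertex_algebra C eps;
  eps_heis : forall i n v, rho (h i) n v = vmode eps (ht1 C i) n%:~R v;
  eps_root : forall a n v, is_root a ->
    rho (e a) n v = vmode eps (e_ C a) n%:~R v;
  eps_intertwining : forall lam mu, intertwining C eps lam mu }.

Context (rho : g -> int -> L -> L).

Inductive current_monomial (v : L) : L -> Prop :=
| CurrentMonomial1 : current_monomial v v
| CurrentMonomialS x (m : nat) u :
    current_monomial v u -> current_monomial v (rho x m%:Z u).

(* U(g[t]) v *)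
Definition current_module (v : L) : set L := lspan (current_monomial v).

(* nu in h^* is given by its values on the h i. *)
Definition is_weight_of (U : set L) (nu : 'rV[C]_r) : Prop :=
  exists u : L, [/\ U u, u <> 0 & forall i, rho (h i) 0 u = nu 0 i *: u].

Definition Fdag (lam : P) : set L :=
  [set v | sector lam v /\
     forall nu, is_weight_of (current_module v) nu ->
       exists2 mu : P, nu = map_mx intr mu & wle mu lam].

End AffineAction.

(* Main.v *)
(** For [x] in [g] and [m >= 0] the commutator formula gives
    [xt^m (A_(k) B) = A_(k) (xt^m B) + \sum_j 'C(m, j) (xt^j A)_(m+k-j) B], so the
    span of all [A_(k) B], with [A] in [F_lam] and [B] in [F_mu], is stable under
    [g[t]].  Membership in [F_lam] only constrains the weights [nu] of the basis
    vectors [(s, nu)] that occur in [U(g[t]) v], because [h] acts diagonally on the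
    Fock basis, and these weights add up under [A_(k) B]. *)
Require Import Defs.
From HB Require Import structures.
From mathcomp Require Import all_boot all_order all_algebra.
From mathcomp Require Import finmap multiset.
From mathcomp Require Import boolp classical_sets fsbigop reals complex.
Import Order.TTheory GRing.Theory Num.Theory.
Local Open Scope classical_set_scope.
Local Open Scope ring_scope.

Set Implicit Arguments.
Unset Strict Implicit.
Unset Printing Implicit Defensive.

(** The sums in [borcherds] run over all naturals; this truncates them where the binomial
    coefficients vanish. *)
Lemma fsum_nat_ord (V : nmodType) (F : nat -> V) (m : nat) :
  (forall j, (m <= j)%N -> F j = 0) ->
  \sum_(j \in [set: nat]) F j = \sum_(j < m) F j.
Proof.
move=> F0; rewrite (fsbigE (iota 0 m)) ?iota_uniq // => [|j _]; last first.
  by rewrite mem_iota add0n -leqNgt; apply: F0.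
rewrite -(big_mkord xpredT F) /index_iota subn0.
by apply: eq_bigl => j; rewrite in_setT.
Qed.

(** * Linear subspaces and spans *)

Section LinearClosure.
Context (C : fieldType).

(** Subspaces are encoded as sets because the Fock space is infinite-dimensional. *)
Definition lin_closed (V : lmodType C) (S : set V) : Prop :=
  S 0 /\ forall a u v, S u -> S v -> S (a *: u + v).

Section Lmodule.
Context (V : lmodType C) (S : set V).
Context (Slin : lin_closed S).

Lemma lin_closedD u v : S u -> S v -> S (u + v).
Proof. by move=> Su Sv; rewrite -[u]scale1r; apply: Slin.2. Qed.

Lemma lin_closedZ a u : S u -> S (a *: u).
Proof. by move=> Su; rewrite -[_ *: _]addr0; apply: Slin.2 => //; exact: Slin.1. Qed.

Lemma lin_closed_sum (I : eqType) (s : seq I) (Q : pred I) (F : I -> V) :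
  (forall i, i \in s -> Q i -> S (F i)) -> S (\sum_(i <- s | Q i) F i).
Proof.
move=> SF; rewrite big_seq_cond; apply: big_ind => [|u v|i /andP[]].
- exact: Slin.1.
- exact: lin_closedD.
- exact: SF.
Qed.

(** By definition such a sum runs over the indices of nonzero terms, or over the empty set if these
    are infinitely many, so it is always a finite sum. *)
Lemma lin_closed_fsum (I : choiceType) (D : set I) (F : I -> V) :
  (forall i, S (F i)) -> S (\sum_(i \in D) F i).
Proof. by move=> SF; apply: lin_closed_sum => i _ _; apply: SF. Qed.

Lemma lspan_min (T : set V) : T `<=` S -> lspan T `<=` S.
Proof.
move=> TS v [s [sT ->]]; apply: lin_closed_sum => p ps _.
by apply: lin_closedZ; apply/TS/sT.
Qed.

End Lmodule.

Lemma sub_lspan (V : lmodType C) (S : set V) : S `<=` lspan S.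
Proof.
move=> v Sv; exists [:: (1, v)]; split; last by rewrite big_seq1 scale1r.
by move=> p; rewrite inE => /eqP->.
Qed.

Lemma lspan_lin_closed (V : lmodType C) (S : set V) : lin_closed (lspan S).
Proof.
split; first by (exists [::]; split; rewrite ?big_nil).
move=> a u v [s [sS ->]] [t [tS ->]].
exists ([seq (a * p.1, p.2) | p <- s] ++ t); split.
  by move=> p; rewrite mem_cat => /orP[/mapP[q qs ->]|/tS//]; exact: (sS q).
rewrite big_cat big_map /= scaler_sumr; congr (_ + _).
by apply: eq_bigr => p _; rewrite scalerA.
Qed.

(** A subspace of maximal dimension inside [S] cannot grow when the line of some [x] in [S] is
    added, so it already contains [x]. This makes [root_span], which speaks of [{vspace g}],
    applicable to sets. *)
Lemma lin_closed_vspace (vT : vectType C) (S : set vT) : lin_closed S ->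
  exists U : {vspace vT}, forall x, x \in U <-> S x.
Proof.
move=> Slin.
pose P d := `[< exists2 U : {vspace vT}, \dim U = d & forall x, x \in U -> S x >].
have P0 : exists d, P d.
  exists 0%N; apply/asboolP; exists 0%VS; first by rewrite dimv0.
  by move=> x; rewrite memv0 => /eqP->; exact: Slin.1.
have Pbound d : P d -> (d <= \dim {:vT})%N.
  by move=> /asboolP[U <- _]; apply/dimvS/subvf.
have [d /asboolP[U <- US] maxU] := ex_maxnP P0 Pbound.
exists U => x; split=> [/US//|Sx].
have /maxU dimUx : P (\dim (U + <[x]>)).
  apply/asboolP; exists (U + <[x]>)%VS => // y /memv_addP[u /US Su].
  by case=> _ /vlineP[a ->] ->; apply: lin_closedD => //; apply: lin_closedZ.
have /eqP-> : (U == U + <[x]>)%VS by rewrite eqEdim addvSl.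
by rewrite memvE addvSr.
Qed.

End LinearClosure.

(** * Weights of basis vectors occurring in a Fock vector *)

Section Supports.
Context (C : numFieldType) (X : ade_type).
Local Notation r := (rank X).
Local Notation P := (weight X).
Local Notation L := (fock C X).
Implicit Types (lam mu : P) (D : set P) (v : L) (b : fock_basis X).

(** Since [(s, lam)] has weight [lam], this is the sum of the weight spaces with weight in [D]. *)
Definition supported D : set L :=
  [set v | forall b, b \in msupp v -> D b.2].

Lemma supported_lin_closed D : lin_closed (supported D).
Proof.
split=> [b|a u v Du Dv b]; first by rewrite msupp0 inE.
move/(fsubsetP (msuppD_le _ _)); rewrite inE => /orP[|/Dv//].
by move/(fsubsetP (msuppZ_le _ _))/Du.
Qed.

Lemma msupp_basis b : msupp (<< b >> : L) = [fset b]%fset.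
Proof. by rewrite msuppU oner_eq0. Qed.

Lemma mcoeff_basis b : (<< b >> : L)@_b = 1.
Proof. exact: mcoeffUU. Qed.

Lemma mcoeff_lin a (u v : L) b : (a *: u + v)@_b = a * u@_b + v@_b.
Proof. by rewrite mcoeffD mcoeffZ. Qed.

Lemma supported_basis D b : D b.2 -> supported D << b >>.
Proof. by move=> Db b'; rewrite msupp_basis in_fset1 => /eqP->. Qed.

Lemma supported_lin_ext D D' (f : fock_basis X -> L) :
  (forall b, D b.2 -> supported D' (f b)) ->
  supported D `<=` lin_ext f @^-1` supported D'.
Proof.
move=> fD v Dv; apply: (lin_closed_sum (supported_lin_closed _)) => b bv _.
by apply: (lin_closedZ (supported_lin_closed _)); apply: fD; apply: Dv.
Qed.

Lemma supported_heis D (h : 'rV[C]_r) k v :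
  supported D v -> supported D (heis h k v).
Proof.
have DZ c b : D b.2 -> supported D (c *: << b >>).
  move=> Db; apply: (lin_closedZ (supported_lin_closed _)).
  exact: supported_basis.
apply: supported_lin_ext => b Db; case: k => [[|q]|p]; first exact: DZ.
  by apply: (lin_closed_sum (supported_lin_closed _)) => j _ _; apply: DZ.
by apply: (lin_closed_sum (supported_lin_closed _)) => j _ _; apply: DZ.
Qed.

Lemma supported_exp_coef D (A : nat -> L -> L) p v :
  (forall k u, supported D u -> supported D (A k u)) ->
  supported D v -> supported D (exp_coef A p v).
Proof.
move=> AD Dv; apply: (lin_closed_sum (supported_lin_closed _)) => m _ _.
apply: (lin_closedZ (supported_lin_closed _)).
move: (nat_of_ord m) => {m} m; elim: m p => [|m IH] p /=.
  by case: ifP => // _; exact: (supported_lin_closed D).1.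
apply: (lin_closed_sum (supported_lin_closed _)) => k _ _.
exact/AD/IH.
Qed.

Context (eps : P -> P -> int).

(** Heisenberg operators change only the multiset of a basis vector; the single shift of the weight,
    by [lam], comes from [e^lam]. *)
Lemma supported_monomial_mode s lam mu n v :
  supported [set mu] v ->
  supported [set lam + mu] (monomial_mode eps s lam n v).
Proof.
elim: s n v => [|ip s IH] n v mu_v /=.
  apply: supported_lin_ext mu_v => b bmu.
  apply: (lin_closed_fsum (supported_lin_closed _)) => pq.
  apply: supported_exp_coef => [k u Du|].
    by apply: (lin_closedZ (supported_lin_closed _)); apply: supported_heis.
  apply: supported_exp_coef => [k u Du|].
    by apply: (lin_closedZ (supported_lin_closed _)); apply: supported_heis.
  apply: (lin_closedZ (supported_lin_closed _)).
  by apply: supported_basis; rewrite /= bmu.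
by apply: (lin_closedD (supported_lin_closed _));
  apply: (lin_closed_fsum (supported_lin_closed _)) => j;
  [apply: (lin_closedZ (supported_lin_closed _)); apply: supported_heis|];
  apply: IH => //; apply: (lin_closedZ (supported_lin_closed _));
  apply: supported_heis.
Qed.

Lemma supported_vmode D D' D'' A n B :
  (forall lam mu, D lam -> D' mu -> D'' (lam + mu)) ->
  supported D A -> supported D' B -> supported D'' (vmode eps A n B).
Proof.
move=> DD'' DA D'B.
apply: (lin_closed_sum (supported_lin_closed _)) => a aA _.
apply: (lin_closed_sum (supported_lin_closed _)) => b bB _.
apply: (lin_closedZ (supported_lin_closed _)) => c.
have bb : supported [set b.2] << b >> by exact: supported_basis.
move=> /(supported_monomial_mode bb) ->.
apply: DD''; [exact: DA|exact: D'B].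
Qed.

Lemma supported_sector lam : supported [set mu | wle mu lam] `<=` sector lam.
Proof.
(* The sign is reversed because [sector] takes [b.2 - lam] while [wle] gives [lam - b.2]. *)
move=> v lam_v b /lam_v[a lamE]; exists (fun i => - (a i)%:Z).
rewrite -[LHS]opprB lamE -sumrN; apply: eq_bigr => i _.
by rewrite mulrNz -pmulrn.
Qed.

Lemma sector_basis s lam : root_lattice lam -> sector 0 (<< (s, lam) >> : L).
Proof. by move=> lamQ b; rewrite msupp_basis in_fset1 subr0 => /eqP->. Qed.

Lemma lin_ext_basis (f : fock_basis X -> L) b : lin_ext f << b >> = f b.
Proof. by rewrite /lin_ext msupp_basis big_seq_fset1 mcoeff_basis scale1r. Qed.

Lemma fock_expansion v : v = \sum_(b <- msupp v) v@_b *: << b >>.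
Proof.
rewrite {1}[v]monalgE; apply: eq_bigr => b _.
by apply/malgP => c; rewrite mcoeffZ [LHS]mcoeffU [_@_c in RHS]mcoeffU mulrnAr mulr1.
Qed.

(** * The vacuum field and the zero mode of [alpha_i t^-1] *)

Lemma heis0 k v : heis 0 k v = 0.
Proof.
rewrite /heis /lin_ext big1 // => b _; case: k => [[|q]|p].
- by rewrite big1 ?scale0r ?scaler0 // => i _; rewrite mxE mul0r.
- rewrite big1 ?scaler0 // => j _.
  by rewrite big1 ?mulr0 ?mul0r ?scale0r // => i _; rewrite mxE mul0r.
- by rewrite big1 ?scaler0 // => i _; rewrite mxE scale0r.
Qed.

Lemma to_h0 : to_h C (0 : P) = 0.
Proof. by rewrite /to_h map_mx0 mul0mx. Qed.

Lemma exp_coef0 (A : nat -> L -> L) p v :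
  (forall k u, A k u = 0) -> exp_coef A p v = if p == 0%N then v else 0.
Proof.
move=> A0; rewrite /exp_coef big_ord_recl /= fact0 invr1 scale1r.
rewrite big1 ?addr0 // => m _.
by rewrite big1 ?scaler0 // => k _; rewrite A0.
Qed.

Lemma wform0l mu : wform 0 mu = 0.
Proof. by rewrite /wform map_mx0 !mul0mx mxE. Qed.

Context (eps0l : forall mu, eps 0 mu = 1).

(** For weight 0 both exponentials reduce to their constant terms and [z^lam] is trivial, so the
    field of [|0>] is the identity. *)
Lemma exp_mode0_basis n b :
  exp_mode eps 0 n << b >> = if n == -1 then << b >> else 0 :> L.
Proof.
rewrite /exp_mode lin_ext_basis eps0l scale1r add0r -surjective_pairing wform0l.
have term pq : exp_minus 0 pq.1 (exp_plus 0 pq.2 << b >>)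
    = if pq == (0, 0)%N then << b >> else 0 :> L.
  rewrite /exp_minus /exp_plus !exp_coef0 => [|k u|k u];
    rewrite ?to_h0 ?heis0 ?scaler0 //.
  by case: pq => -[|p] -[|q].
under eq_fsbigr do rewrite term.
case: eqP => [->|n1]; last first.
  (* The only pair with a nonzero term, [(0, 0)], is an index of the sum only if [- n - 1 = 0]. *)
  rewrite fsbig1 // => -[p q] /= pq; case: eqP => // -[p0 q0].
  case: n1; apply/eqP.
  by rewrite -subr_eq0 opprK -oppr_eq0 opprD -pq p0 q0.
rewrite -(fsbig_widen [set (0, 0)%N]) ?fsbig_set1 ?eqxx //.
  by move=> _ ->.
by move=> pq [_ /eqP /negPf /= ->].
Qed.

Lemma exp_mode0 n v : exp_mode eps 0 n v = if n == -1 then v else 0.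
Proof.
rewrite /exp_mode; set f := (X in lin_ext X).
have fE b : f b = if n == -1 then << b >> else 0.
  by rewrite -exp_mode0_basis /exp_mode lin_ext_basis.
rewrite /lin_ext; under eq_bigr do rewrite fE.
by case: eqP => _; [rewrite -fock_expansion|rewrite big1 // => b _; rewrite scaler0].
Qed.

Lemma vmode_lin_ext (A B : L) n :
  vmode eps A n B =
  lin_ext (fun a => lin_ext (fun b =>
    monomial_mode eps (enum_mset a.1) a.2 n (<< b >> : L)) B) A.
Proof.
apply: eq_bigr => a _; rewrite /lin_ext scaler_sumr.
by apply: eq_bigr => b _; rewrite scalerA.
Qed.

Lemma zbinom0 (m : int) : zbinom C m 0 = 1.
Proof. by rewrite /zbinom big_ord0 divr1. Qed.

(** The normally ordered product of [Y(alpha_i t^-1, z)] with the identity field [Y(e^0, z)] keeps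
    only the term [j = 0], which is the operator [alpha_i t^0]. *)
Lemma vmode_ht1_0 i b :
  vmode eps (ht1 C i) 0 << b >> = (b.2 0 i)%:~R *: << b >>.
Proof.
rewrite vmode_lin_ext !lin_ext_basis /= enum_msetn /=.
have modeN1 (j : int) : (0 - j%:~R - 1 == -1 :> rat) = (j == 0).
  by rewrite sub0r -subr_eq0 opprK subrK oppr_eq0 intr_eq0.
rewrite fsbig1 ?add0r => [|j /= j_lt0]; last first.
  rewrite exp_mode0 modeN1 lt_eqF // /heis_mode /heis /lin_ext.
  by rewrite msupp0 big_seq_fset0 scaler0.
rewrite -(fsbig_widen [set 0]) => [|j ->//|j [/= _ /eqP j0]]; last first.
  by rewrite exp_mode0 modeN1 (negPf j0).
rewrite fsbig_set1 exp_mode0 modeN1 eqxx /heis_mode zbinom0 scale1r.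
have -> : (b.2 0 i)%:~R = \sum_j alpha C i 0 j * (b.2 0 j)%:~R.
  rewrite (bigD1 i) //= mxE !eqxx mul1r big1 ?addr0 // => j /negPf ji.
  by rewrite mxE ji andbF mul0r.
by rewrite /heis /= lin_ext_basis.
Qed.

End Supports.

(** * Current-stable subspaces and a description of [Fdag] by supports *)

Section CurrentModule.
Context (C : numFieldType) (X : ade_type) (g : lie_algebra C).
Local Notation r := (rank X).
Local Notation P := (weight X).
Local Notation L := (fock C X).
Context (h : 'I_r -> g) (e : P -> g) (kappa : g -> g -> C).
Context (rho : g -> int -> L -> L) (eps : P -> P -> int).
Context (he : root_decomposition h e) (rhoP : level_one_action kappa rho).
Context (epsP : admissible_signs h e rho eps).
Implicit Types (lam mu : P) (v : L) (M : set L).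

Definition current_stable M : Prop :=
  lin_closed M /\ forall x (m : nat) v, M v -> M (rho x m v).

Lemma rho0r x n : rho x n 0 = 0.
Proof.
have := rho_linear_r rhoP x n 1 0 0; rewrite !scale1r addr0 => /eqP.
by rewrite -subr_eq0 opprD addNKr oppr_eq0 => /eqP.
Qed.

Lemma rho0l n v : rho 0 n v = 0.
Proof.
have := rho_linear_l rhoP 1 0 0 n v; rewrite !scale1r addr0 => /eqP.
by rewrite -subr_eq0 opprD addNKr oppr_eq0 => /eqP.
Qed.

Lemma rho_lin_closed M x n : lin_closed M -> lin_closed (rho x n @^-1` M).
Proof.
move=> Mlin; split=> [|a u v Mu Mv] /=; first by rewrite rho0r; exact: Mlin.1.
by rewrite (rho_linear_r rhoP); apply: Mlin.2.
Qed.

Lemma current_module_stable v : current_stable (current_module rho v).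
Proof.
have lin := lspan_lin_closed (current_monomial rho v).
split=> // x m u; apply: (lspan_min (rho_lin_closed x m lin)).
by move=> w vw; apply: sub_lspan; apply: CurrentMonomialS.
Qed.

Lemma current_module_self v : current_module rho v v.
Proof. by apply: sub_lspan; apply: CurrentMonomial1. Qed.

Lemma current_module_min M v :
  current_stable M -> M v -> current_module rho v `<=` M.
Proof.
move=> [Mlin Mrho] Mv; apply: lspan_min => // u.
by elim=> // x m w _; apply: Mrho.
Qed.

(** By [eps_heis] the action of [h i] is the zero mode of [ht1 C i], which is diagonal on the Fock
    basis. *)
Lemma rho_cartan_coef i v c :
  (rho (h i) 0 v)@_c = (c.2 0 i)%:~R * v@_c.
Proof.
pose S : set L := [set u | (rho (h i) 0 u)@_c = (c.2 0 i)%:~R * u@_c].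
have Slin : lin_closed S.
  rewrite {}/S; split=> [|a u w /= Su Sw] /=; first by rewrite rho0r !mcoeff0 mulr0.
  rewrite (rho_linear_r rhoP) [LHS]mcoeff_lin [(_ + _)@_c in RHS]mcoeff_lin.
  by rewrite Su Sw mulrDr mulrCA.
rewrite [v]fock_expansion; apply: (lin_closed_sum Slin) => b _ _.
apply: (lin_closedZ Slin); rewrite /S /= (eps_heis epsP) vmode_ht1_0.
  by rewrite mcoeffZ mcoeffU; case: eqP => [->|] //=; rewrite !mulr0.
exact: eps0l epsP.
Qed.

(* If [c] and [b] occur in [u] with weights that differ under [h i], then
   [(h i - (c.2 0 i)) u] still contains [b], but no longer [c]; so [b] occurs in
   a weight vector of [M]. *)
Lemma supported_of_weights (D : set P) M : current_stable M ->
  (forall nu, is_weight_of h rho M nu ->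
     exists2 mu : P, nu = map_mx intr mu & D mu) ->
  M `<=` supported D.
Proof.
move=> [Mlin Mrho] MD u Mu b.
have [n] := ubnP #|` msupp u|; elim: n u Mu => // n IH u Mu u_n bu.
have [/allP /= ub|/allPn[c cu cb]] :=
    boolP (all (fun c : fock_basis X => c.2 == b.2) (msupp u)).
  have [|mu /rowP bmu] := MD (map_mx intr b.2); last first.
    suff -> : b.2 = mu by [].
    by apply/rowP => i; move: (bmu i); rewrite !mxE => /intr_inj.
  exists u; split=> // [u0|i]; first by rewrite u0 msupp0 in_fset0 in bu.
  apply/malgP => c; rewrite rho_cartan_coef mcoeffZ mxE.
  have [/ub/eqP-> //|/mcoeff_outdom->] := boolP (c \in msupp u).
  by rewrite !mulr0.
have /existsP[i ci] : [exists i, c.2 0 i != b.2 0 i].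
  rewrite -negb_forall; apply: contra cb => /forallP cb.
  by apply/eqP/rowP => i; apply/eqP.
pose u' := - (c.2 0 i)%:~R *: u + rho (h i) 0 u.
have u'E d : u'@_d = (d.2 0 i - c.2 0 i)%:~R * u@_d.
  by rewrite mcoeffD mcoeffZ rho_cartan_coef -mulrDl addrC -intrB.
apply: (IH u').
- by apply: Mlin.2 => //; exact: (Mrho _ 0%N).
- rewrite -ltnS; apply: leq_trans u_n; rewrite ltnS; apply: fproper_ltn_card.
  rewrite fproperE; apply/andP; split.
    apply/fsubsetP => d; rewrite -!mcoeff_neq0 u'E.
    by rewrite mulf_eq0 negb_or => /andP[].
  apply/fsubsetPn; exists c => //.
  by rewrite -mcoeff_eq0 u'E subrr mul0r.
- by rewrite -mcoeff_neq0 u'E mulf_neq0 ?mcoeff_neq0 // intr_eq0 subr_eq0 eq_sym.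
Qed.

(** A nonzero weight vector has some basis vector [b] in its support; comparing coefficients at [b]
    forces its weight to be [b.2]. *)
Lemma weight_of_supported (D : set P) M nu :
  M `<=` supported D -> is_weight_of h rho M nu ->
  exists2 mu : P, nu = map_mx intr mu & D mu.
Proof.
move=> MD [u [Mu u0 uE]]; have [msupp_u0|[b bu]] := fset_0Vmem (msupp u).
  by case: u0; rewrite [u]fock_expansion msupp_u0 big_seq_fset0.
exists b.2; last exact: (MD u).
apply/rowP => i; rewrite mxE; move: bu; rewrite -mcoeff_neq0 => /mulIf; apply.
by rewrite -rho_cartan_coef uE mcoeffZ.
Qed.

(** This trades weight vectors for supports, a condition that is linear and compatible with modes.
    The sector condition is recovered from [v] lying in its own current module, as weights below
    [lam] are congruent to [lam] modulo the root lattice. *)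
Lemma FdagP lam v : Fdag h rho lam v <->
  current_module rho v `<=` supported [set mu | wle mu lam].
Proof.
split=> [[_ Fv]|vlam].
  exact: (supported_of_weights (current_module_stable v)).
split; first exact/supported_sector/vlam/current_module_self.
by move=> nu; apply: weight_of_supported.
Qed.

Lemma Fdag_supported lam v :
  Fdag h rho lam v -> supported [set mu | wle mu lam] v.
Proof. by move/FdagP; apply; apply: current_module_self. Qed.

Lemma Fdag_rho lam x (m : nat) v : Fdag h rho lam v -> Fdag h rho lam (rho x m v).
Proof.
move=> /FdagP vlam; apply/FdagP => u; move: (current_module_stable v) => st.
move/(current_module_min st) => /(_ _)/vlam; apply.
by apply: st.2; exact: current_module_self.
Qed.

(** * The commutator formula and the span of all modes *)

Lemma zbinom_small (m j : nat) : (m < j)%N -> zbinom C m j = 0.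
Proof.
by move=> mj; rewrite /zbinom (bigD1 (Ordinal mj)) //= subrr !mul0r.
Qed.

(** This is the Borcherds identity with [n = 0], for [x] whose currents are the modes of a vector
    [a] of [L_0]: on the right only [j = 0] survives, on the left only [j <= m]. *)
Lemma rho_commutator lam mu x a (m : nat) k b c :
  sector 0 a -> (forall n v, rho x n v = vmode eps a n%:~R v) ->
  sector lam b -> sector mu c ->
  rho x m (vmode eps b k c)
  = \sum_(j < m.+1) zbinom C m j *: vmode eps (rho x j b) (m%:R + k - j%:R) c
    + vmode eps b k (rho x m c).
Proof.
move=> a0 xE blam cmu; have [_ _ _ /(_ a a0 m 0 k)] := eps_intertwining epsP blam cmu.
set bl := (X in X = _ -> _); set br := (X in _ = X -> _) => blr.
pose F (j : nat) := zbinom C m j *: vmode eps (rho x j b) (m%:R + k - j%:R) c.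
have F0 j : (m < j)%N -> F j = 0 by move=> mj; rewrite /F zbinom_small ?scale0r.
pose G (j : nat) := ((-1) ^+ j * zbinom C 0 j) *:
  (rho x (m%:Z - j%:Z) (vmode eps b (k + j%:R) c)
   - vmode eps b (k - j%:R) (rho x (m%:Z + j%:Z) c)).
have G0 j : (0 < j)%N -> G j = 0.
  by move=> j0; rewrite /G zbinom_small ?mulr0 ?scale0r.
have blE : bl = \sum_(j < m.+1) F j.
  rewrite -(fsum_nat_ord F0); apply: eq_fsbigr => j _.
  by rewrite /F xE add0r.
have brE : br = G 0%N.
  transitivity (\sum_(j < 1) G j); last exact: big_ord1.
  rewrite -(fsum_nat_ord G0); apply: eq_fsbigr => j _.
  by rewrite /G !xE addr0 expr0z scale1r add0r.
rewrite -blE blr brE /G expr0 zbinom0 mulr1 scale1r !subr0.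
by rewrite subrK.
Qed.

(** All indices [k] are taken together because the commutator terms have the shifted indices
    [m + k - j]. *)
Lemma vmode_span_stable lam mu :
  current_stable (lspan [set v | exists A k B,
    [/\ Fdag h rho lam A, Fdag h rho mu B & v = vmode eps A k B]]).
Proof.
set S := [set v | _]; have lin := lspan_lin_closed S; split=> //.
(* The commutator formula is available only for the [h i] and the root vectors [e a]. As [Q] is a
   linear subspace containing them, [root_span] makes it all of [g]. *)
pose Q := [set x | forall (m : nat) v, lspan S v -> lspan S (rho x m v)].
have Qlin : lin_closed Q.
  split=> [m v Sv|a x y Qx Qy m v Sv].
    by rewrite rho0l; exact: lin.1.
  by rewrite (rho_linear_l rhoP); apply: lin.2; [apply: Qx|apply: Qy].
have gen x a : sector 0 a -> (forall n v, rho x n v = vmode eps a n%:~R v) -> Q x.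
  move=> a0 xE m v; apply: (lspan_min (rho_lin_closed x m lin)).
  move=> _ [A [k [B [FA FB ->]]]] /=.
  rewrite (rho_commutator m k a0 xE (supported_sector (Fdag_supported FA))
             (supported_sector (Fdag_supported FB))).
  apply: (lin_closedD lin).
    apply: (lin_closed_sum lin) => j _ _; apply/(lin_closedZ lin)/sub_lspan.
    by exists (rho x j A), (m%:R + k - j%:R), B; split=> //; apply: Fdag_rho.
  by apply/sub_lspan; exists A, k, (rho x m B); split=> //; apply: Fdag_rho.
have [U UQ] := lin_closed_vspace Qlin.
have Ufull : U = fullv.
  apply: (root_span he) => [i|a a_root]; apply/UQ.
    apply: (gen _ (ht1 C i)); last by move=> n v; exact: eps_heis epsP _ _ _.
    by apply: sector_basis; exists (fun=> 0); rewrite big1.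
  apply: (gen _ (e_ C a)); last by move=> n v; exact: eps_root epsP _ _ _ a_root.
  by apply: sector_basis; case: a_root.
by move=> x; apply/UQ; rewrite Ufull memvf.
Qed.

Lemma wleD (lam lam' mu mu' : P) :
  wle lam lam' -> wle mu mu' -> wle (lam + mu) (lam' + mu').
Proof.
move=> [a lamE] [b muE]; exists (fun i => a i + b i)%N.
rewrite opprD addrACA lamE muE -big_split.
by apply: eq_bigr => i _; rewrite mulrnDr.
Qed.

(** By minimality the current module of [v] stays inside the stable span of all modes [A_(k) B],
    whose supports are bounded by adding those of [A] and [B]. *)
Lemma mode_span_Fdag lam mu n :
  mode_span eps n (Fdag h rho lam) (Fdag h rho mu) `<=` Fdag h rho (lam + mu).
Proof.
move=> v Fv; apply/FdagP.
have st := vmode_span_stable lam mu; have Slin := st.1.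
apply: (subset_trans (current_module_min st _)).
  move: Fv; apply: lspan_min => // _ [A [B [FA FB ->]]].
  by apply: sub_lspan; exists A, n, B.
apply: lspan_min; first exact: supported_lin_closed.
move=> _ [A [k [B [/Fdag_supported FA /Fdag_supported FB ->]]]].
by apply: supported_vmode FA FB => lam' mu'; apply: wleD.
Qed.

End CurrentModule.

Theorem proposition4p3 (R : realType) (X : ade_type) (N : nat)
    (g : lie_algebra R[i]) (h : 'I_(rank X) -> g) (e : weight X -> g)
    (kappa : g -> g -> R[i]) (rho : g -> int -> fock R[i] X -> fock R[i] X)
    (eps : weight X -> weight X -> int) :
  is_PQ_exponent X N ->
  simple_lie g ->
  root_decomposition h e ->
  normalized_form h kappa ->
  level_one_action kappa rho ->
  admissible_signs h e rho eps ->
  forall lam mu : weight X, dominant lam -> dominant mu ->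
  forall n : rat, (exists m : int, n = m%:~R / N%:R) ->
    mode_span eps n (Fdag h rho lam) (Fdag h rho mu)
      `<=` Fdag h rho (lam + mu).
Proof.
move=> _ _ he _ rhoP epsP lam mu _ _ n _.
exact: mode_span_Fdag he rhoP epsP lam mu n.
Qed.
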